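(* Let $1 \le r \le n$ be integers, let $\mathbf{A}, \mathbf{M} \in \mathbb{R}^{n\times n}$ be symmetric positive definite matrices, and let $\mathbf{Q} \in \mathbb{R}^{n \times r}$ have orthonormal columns ($\mathbf{Q}^\top\mathbf{Q} = \mathbf{I}$). Let $\lambda_1 \le \cdots \le \lambda_n$ be the generalized eigenvalues of $\mathbf{A}$ with respect to $\mathbf{M}$, with $\mathbf{M}$-orthonormal generalized eigenvectors $\boldsymbol{\phi}_1, \dots, \boldsymbol{\phi}_n$. Let $\widetilde{\lambda}_1 \le \cdots \le \widetilde{\lambda}_r$ be the generalized eigenvalues of $\widehat{\mathbf{A}} = \mathbf{Q}^\top \mathbf{A}\mathbf{Q}$ with respect to $\widehat{\mathbf{M}} = \mathbf{Q}^\top \mathbf{M}\mathbf{Q}$, with $\widehat{\mathbf{M}}$-orthonormal generalized eigenvectors $\widehat{\boldsymbol{\phi}}_1,\dots,\widehat{\boldsymbol{\phi}}_r \in \mathbb{R}^r$, and set $\widetilde{\boldsymbol{\phi}}_k = \mathbf{Q}\widehat{\boldsymbol{\phi}}_k \in \mathbb{R}^n$. Let $\mathbf{P}_{\mathbf{A}} = \mathbf{Q}\widehat{\mathbf{A}}^{-1}\mathbf{Q}^\top\mathbf{A}$, and assume that the $n \times r$ matrix $\mathbf{P}_{\mathbf{A}}[\boldsymbol{\phi}_1, \dots, \boldsymbol{\phi}_r]$ has full rank $r$, so that for $1\le k\le r$ $$\kappa_k = \sup_{\mathbf{y} \in \operatorname{span}\{\boldsymbol{\phi}_1,\dots,\boldsymbol{\phi}_k\}\setminus\{\mathbf{0}\}}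 \frac{\|\mathbf{y}\|_{\mathbf{M}}}{\|\mathbf{P}_{\mathbf{A}}\mathbf{y}\|_{\mathbf{M}}} < \infty.$$ Assume that $r=n$ or $\lambda_r < \lambda_{r+1}$. Let $\nu_1 < \nu_2 < \cdots < \nu_\ell$ be the distinct values among $\lambda_1,\dots,\lambda_r$, and for $1\le j\le \ell$ let $\mathcal{S}_j = \{k \in \{1,\dots,r\} : \lambda_k = \nu_j\}$, $\mathcal{S}_j^{\mathrm{c}} = \{1,\dots,r\}\setminus \mathcal{S}_j$, and $\mathcal{E}_j = \operatorname{span}\{\boldsymbol{\phi}_k : k\in\mathcal{S}_j\} = \{\mathbf{x}\in\mathbb{R}^n : \mathbf{A}\mathbf{x} = \nu_j\mathbf{M}\mathbf{x}\}$. Let $1 \le j \le \ell$ and assume that $\nu_j \notin [\lambda_k, \kappa_k^2\lambda_k]$ for every $k\in\mathcal{S}_j^{\mathrm{c}}$ (which guarantees $\nu_j \ne \widetilde{\lambda}_k$ for all such $k$). Set $$\tau_j = \frac{\nu_j}{\min_{k\in\mathcal{S}_j^{\mathrm{c}}} |\nu_j - \widetilde{\lambda}_k|} < \infty$$ (with $\tau_j = 0$ if $\mathcal{S}_j^{\mathrm{c}}=\emptyset$), and let $$\widetilde{\mathbf{P}}_{\mathbf{M}}^{\mathcal{S}_j} = \sum_{k\in\mathcal{S}_j} \widetilde{\boldsymbol{\phi}}_k\widetilde{\boldsymbol{\phi}}_k^\top\mathbf{M} \in \mathbb{R}^{n\times n}.$$ Then for every $\mathbf{x}\in\mathcal{E}_j$,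 $$\left\| \left(\mathbf{I} - \widetilde{\mathbf{P}}_{\mathbf{M}}^{\mathcal{S}_j}\right)\mathbf{x}\right\|_{\mathbf{M}} \le (1+\tau_j)\,\left\|(\mathbf{I}-\mathbf{P}_{\mathbf{A}})\mathbf{x}\right\|_{\mathbf{M}}.$$
   Context: All matrices and vectors are real. For a symmetric matrix $\mathbf{A}$ and a symmetric positive definite matrix $\mathbf{M}$ in $\mathbb{R}^{n\times n}$, a generalized eigenvector of $\mathbf{A}$ with respect to $\mathbf{M}$ with generalized eigenvalue $\lambda\in\mathbb{R}$ is a nonzero $\boldsymbol{\phi}\in\mathbb{R}^n$ with $\mathbf{A}\boldsymbol{\phi} = \lambda\mathbf{M}\boldsymbol{\phi}$. The generalized eigenvalues are listed in ascending order, repeated according to multiplicity, together with a fixed basis $\boldsymbol{\phi}_1,\dots,\boldsymbol{\phi}_n$ of corresponding generalized eigenvectors satisfying $\mathbf{A}\boldsymbol{\phi}_k = \lambda_k \mathbf{M}\boldsymbol{\phi}_k$ and $\boldsymbol{\phi}_i^\top\mathbf{M}\boldsymbol{\phi}_k = \delta_{ik}$. The same conventions apply to the $r\times r$ pair $(\widehat{\mathbf{A}},\widehat{\mathbf{M}})$: $\widehat{\mathbf{A}}\widehat{\boldsymbol{\phi}}_k = \widetilde{\lambda}_k\widehat{\mathbf{M}}\widehat{\boldsymbol{\phi}}_k$ and $\widehat{\boldsymbol{\phi}}_i^\top\widehat{\mathbf{M}}\widehat{\boldsymbol{\phi}}_k=\delta_{ik}$. The $\mathbf{M}$-induced norm is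 $\|\mathbf{x}\|_{\mathbf{M}} = \sqrt{\mathbf{x}^\top\mathbf{M}\mathbf{x}}$. *)

(* Defs.v *)
From mathcomp Require Import all_boot all_order all_algebra.
From mathcomp Require Import boolp classical_sets constructive_ereal reals ereal.

Set Implicit Arguments.
Unset Strict Implicit.
Unset Printing Implicit Defensive.

Import Order.TTheory GRing.Theory Num.Theory.
Local Open Scope classical_set_scope.
Local Open Scope ring_scope.

Section GeneralizedEigenproblem.
Variable R : realType.

Definition mdot n (M : 'M[R]_n) (x y : 'cV[R]_n) : R := (x^T *m M *m y) 0 0.

Definition mnorm n (M : 'M[R]_n) (x : 'cV[R]_n) : R := Num.sqrt (mdot M x x).

Definition spd n (M : 'M[R]_n) : Prop :=
  M^T = M /\ forall x : 'cV[R]_n, x != 0 -> 0 < mdot M x x.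

(* The [n] vectors [phi k] are M-orthonormal, hence form a basis, so [lam]
   lists all the generalized eigenvalues, with multiplicity. *)
Definition gen_eigensystem n (A M : 'M[R]_n) (lam : 'I_n -> R)
    (phi : 'I_n -> 'cV[R]_n) : Prop :=
  [/\ {homo lam : i k / (i <= k)%N >-> i <= k},
      forall k, A *m phi k = lam k *: (M *m phi k)
    & forall i k, mdot M (phi i) (phi k) = (i == k)%:R].

Definition compress n r (Q : 'M[R]_(n, r)) (A : 'M[R]_n) : 'M[R]_r :=
  Q^T *m A *m Q.

Definition projA n r (Q : 'M[R]_(n, r)) (A : 'M[R]_n) : 'M[R]_n :=
  Q *m invmx (compress Q A) *m Q^T *m A.

Definition cols n r (v : 'I_r -> 'cV[R]_n) : 'M[R]_(n, r) :=
  \matrix_(i, k) v k i 0.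

Definition vspan n r (v : 'I_r -> 'cV[R]_n) (S : {set 'I_r}) :
    {vspace 'cV[R]_n} :=
  <<[seq v k | k in S]>>%VS.

(* [v] lists the vectors phi_1, ..., phi_r. The supremum and the quotient are
   taken in \bar R, where a / 0 = +oo for a > 0. *)
Definition kappa n r (M P : 'M[R]_n) (v : 'I_r -> 'cV[R]_n) (k : 'I_r) :
    \bar R :=
  ereal_sup [set ((mnorm M y)%:E / (mnorm M (P *m y))%:E)%E
            | y in [set y : 'cV[R]_n |
                     y != 0 /\ y \in vspan v [set i : 'I_r | (i <= k)%N]%SET]].

Definition eigenset r (lam : 'I_r -> R) (nu : R) : {set 'I_r} :=
  [set k | lam k == nu]%SET.

Definition tau r (nu : R) (lamt : 'I_r -> R) (S : {set 'I_r}) : R :=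
  if [pick k in ~: S]%SET is Some k0 then
    let kmin := [arg min_(k < k0 in (~: S)%SET) `|nu - lamt k|]%O in
    nu / `|nu - lamt kmin|
  else 0.

Definition spectral_proj n r (M : 'M[R]_n) (v : 'I_r -> 'cV[R]_n)
    (S : {set 'I_r}) : 'M[R]_n :=
  \sum_(k in S) v k *m (v k)^T *m M.

End GeneralizedEigenproblem.

(* Main.v *)
Require Import Defs.
From mathcomp Require Import all_boot all_order all_algebra.
From mathcomp Require Import boolp classical_sets constructive_ereal reals ereal.
From mathcomp Require Import ring lra.

(** Both eigensystems diagonalise their pencils, so Courant-Fischer arguments
    give [lam_k <= lamt_k <= kappa_k^2 lam_k]: a dimension count produces a
    nonzero vector of span{Q phih_1, .., Q phih_k} M-orthogonal to
    phi_1, .., phi_(k-1), and a nonzero y in span{phi_1, .., phi_k} with P_A y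
    M-orthogonal to the first k-1 Ritz vectors, and one compares Rayleigh
    quotients, P_A being an A-contraction. Hence nu_j differs from lamt_k for k
    outside S.  For x in the eigenspace put z = P_A x and e = x - z. Then
    (I - P^S) x = (I - P^S) e + (I - P^S) z; the first term is at most |e|, and
    the coordinates of z along the Ritz vectors outside S are
    nu / (lamt_k - nu) times those of e, so the second is at most tau |e|. *)

Set Implicit Arguments.
Unset Strict Implicit.
Unset Printing Implicit Defensive.

Import Order.TTheory GRing.Theory Num.Theory.
Local Open Scope ring_scope.

(** * The inner product and norm induced by a positive definite matrix *)

Section InnerProduct.
Variables (R : realType) (n : nat).
Implicit Types (M : 'M[R]_n) (x y z : 'cV[R]_n).

Lemma mdotDr M x y z : mdot M x (y + z) = mdot M x y + mdot M x z.
Proof. by rewrite /mdot mulmxDr mxE. Qed.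

Lemma mdotZr M x a y : mdot M x (a *: y) = a * mdot M x y.
Proof. by rewrite /mdot -scalemxAr mxE. Qed.

Lemma mdotNr M x y : mdot M x (- y) = - mdot M x y.
Proof. by rewrite -scaleN1r mdotZr mulN1r. Qed.

Lemma mdotBr M x y z : mdot M x (y - z) = mdot M x y - mdot M x z.
Proof. by rewrite mdotDr mdotNr. Qed.

Lemma mdot0r M x : mdot M x 0 = 0.
Proof. by rewrite -(scale0r 0) mdotZr mul0r. Qed.

Lemma mdot_sumr M x (I : Type) (s : seq I) (P : pred I) (F : I -> 'cV[R]_n) :
  mdot M x (\sum_(i <- s | P i) F i) = \sum_(i <- s | P i) mdot M x (F i).
Proof. by rewrite /mdot mulmx_sumr summxE. Qed.

Lemma mdotC M x y : M^T = M -> mdot M x y = mdot M y x.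
Proof.
move=> sM; rewrite /mdot -[in RHS](trmxK (y^T *m M *m x)) [in RHS]mxE.
by rewrite !trmx_mul trmxK sM mulmxA.
Qed.

Lemma mdotDl M x y z : M^T = M -> mdot M (y + z) x = mdot M y x + mdot M z x.
Proof. by move=> sM; rewrite !(mdotC _ x) // mdotDr. Qed.

Lemma mdotZl M x a y : M^T = M -> mdot M (a *: y) x = a * mdot M y x.
Proof. by move=> sM; rewrite !(mdotC _ x) // mdotZr. Qed.

Lemma mdot_ge0 M x : spd M -> 0 <= mdot M x x.
Proof.
case=> _ pM; have [->|/pM/ltW//] := eqVneq x 0; by rewrite mdot0r.
Qed.

(** Cauchy-Schwarz: the square of [<y,y> x - <x,y> y] is nonnegative and expands to [<y,y>] times
    the difference of the two sides. *)
Lemma mdot_cauchy M x y : spd M ->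
  mdot M x y ^+ 2 <= mdot M x x * mdot M y y.
Proof.
move=> sM; have [sym pM] := sM.
have [->|/pM y_gt0] := eqVneq y 0; first by rewrite !mdot0r expr0n mulr0.
have := mdot_ge0 (mdot M y y *: x - mdot M x y *: y) sM.
rewrite -scaleNr mdotDl // !mdotZl // !mdotDr !mdotZr (mdotC y x) //.
set a := mdot M x x; set b := mdot M y y; set c := mdot M x y => h.
rewrite -subr_ge0 -(pmulr_rge0 _ y_gt0) -/b.
by apply: le_trans h _; rewrite le_eqVlt; apply/orP; left; apply/eqP; ring.
Qed.

Lemma mnorm_ge0 M x : 0 <= mnorm M x.
Proof. exact: sqrtr_ge0. Qed.

Lemma sqr_mnorm M x : spd M -> mnorm M x ^+ 2 = mdot M x x.
Proof. by move=> sM; rewrite sqr_sqrtr // mdot_ge0. Qed.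

Lemma mnorm_le M x y a : spd M -> 0 <= a ->
  (mnorm M x <= a * mnorm M y) = (mdot M x x <= a ^+ 2 * mdot M y y).
Proof.
move=> sM a_ge0; rewrite -!sqr_mnorm // -exprMn ler_sqr //.
  exact: mnorm_ge0.
by rewrite nnegrE mulr_ge0 // mnorm_ge0.
Qed.

Lemma mnorm0 M : mnorm M 0 = 0.
Proof. by rewrite /mnorm mdot0r sqrtr0. Qed.

Lemma mnorm_gt0 M x : spd M -> x != 0 -> 0 < mnorm M x.
Proof. by move=> [_ pM] /pM; rewrite sqrtr_gt0. Qed.

Lemma mdot_le_mnorm M x y : spd M -> `|mdot M x y| <= mnorm M x * mnorm M y.
Proof.
move=> sM; rewrite -ler_sqr ?nnegrE ?mulr_ge0 ?mnorm_ge0 //.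
by rewrite exprMn real_normK ?num_real // !sqr_mnorm // mdot_cauchy.
Qed.

Lemma mnormZ M a x : spd M -> mnorm M (a *: x) = `|a| * mnorm M x.
Proof.
move=> sM; have [sym _] := sM.
by rewrite /mnorm mdotZl // mdotZr mulrA -expr2 sqrtrM ?sqr_ge0 // sqrtr_sqr.
Qed.

Lemma mnormD M x y : spd M -> mnorm M (x + y) <= mnorm M x + mnorm M y.
Proof.
move=> sM; have [sym _] := sM.
rewrite -ler_sqr ?nnegrE ?addr_ge0 ?mnorm_ge0 // sqr_mnorm //.
rewrite sqrrD !sqr_mnorm // mdotDl // !mdotDr (mdotC y x) //.
have := le_trans (ler_norm _) (mdot_le_mnorm x y sM); lra.
Qed.

Lemma mnorm_sum M (I : Type) (s : seq I) (F : I -> 'cV[R]_n) : spd M ->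
  mnorm M (\sum_(i <- s) F i) <= \sum_(i <- s) mnorm M (F i).
Proof.
move=> sM; elim: s => [|i s IHs]; first by rewrite !big_nil mnorm0.
by rewrite !big_cons; apply: le_trans (mnormD _ _ sM) _; rewrite lerD2l.
Qed.

Lemma spd_unitmx M : spd M -> M \in unitmx.
Proof.
case=> sym pM; rewrite unitmxE unitfE; apply/negP => /det0P[v v0 vM].
have /pM : v^T != 0 by rewrite -trmx0 (inj_eq trmx_inj).
by rewrite /mdot trmxK vM mul0mx mxE ltxx.
Qed.

End InnerProduct.

(** * Linear combinations and spans in matrix form *)

Lemma mdot_mulmx (R : realType) n p q (M : 'M[R]_n) (B : 'M[R]_(n, p))
    (C : 'M[R]_(n, q)) x y :
  mdot M (B *m x) (C *m y) = (x^T *m (B^T *m M *m C) *m y) 0 0.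
Proof. by rewrite /mdot trmx_mul !mulmxA. Qed.

Lemma mul_cols (R : realType) n r (v : 'I_r -> 'cV[R]_n) (c : 'cV[R]_r) :
  cols v *m c = \sum_k c k 0 *: v k.
Proof.
apply/colP => i; rewrite mxE summxE; apply: eq_bigr => k _.
by rewrite !mxE mulrC.
Qed.

(** Coefficients are extended by zero outside [S], so that every combination runs over all of ['I_r]
    and [mdot_comb] reads them off. *)
Lemma vspanP (R : realType) n r (v : 'I_r -> 'cV[R]_n) (S : {set 'I_r}) x :
  reflect (exists2 c : 'I_r -> R, forall k, k \notin S -> c k = 0
                                & x = \sum_k c k *: v k)
          (x \in vspan v S).
Proof.
rewrite /vspan span_def big_map big_enum /=; apply: (iffP memv_sumP).
- case=> w wS ->.
  have /choice[c cE] k : exists a, k \in S -> w k = a *: v k.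
    by have [/wS/vlineP[a ->]|_] := boolP (k \in S); [exists a | exists 0].
  exists (fun k => if k \in S then c k else 0) => [k /negPf -> //|].
  rewrite [RHS](bigID (mem S)) /= [X in _ + X]big1 ?addr0 => [|k /negPf ->].
    by apply: eq_bigr => k kS; rewrite kS cE.
  by rewrite scale0r.
- case=> c c0 ->; exists (fun k => c k *: v k) => [k _|].
    by apply/vlineP; exists (c k).
  rewrite [LHS](bigID (mem S)) /= [X in _ + X]big1 ?addr0 // => k kS.
  by rewrite c0 // scale0r.
Qed.

(** * Orthonormal families: coordinates, projection, Bessel *)

Section OrthonormalFamily.
Variables (R : realType) (n r : nat) (M : 'M[R]_n) (v : 'I_r -> 'cV[R]_n).
Hypothesis spdM : spd M.
Hypothesis orthov : forall i k, mdot M (v i) (v k) = (i == k)%:R.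

Lemma mdot_comb (c : 'I_r -> R) i : mdot M (v i) (\sum_k c k *: v k) = c i.
Proof.
rewrite mdot_sumr (bigD1 i) //= big1 ?addr0 => [|k ki].
  by rewrite mdotZr orthov eqxx mulr1.
by rewrite mdotZr orthov eq_sym (negPf ki) mulr0.
Qed.

Lemma mdot_comb2 (c d : 'I_r -> R) :
  mdot M (\sum_k c k *: v k) (\sum_k d k *: v k) = \sum_k c k * d k.
Proof.
have [sM _] := spdM; rewrite mdotC // mdot_sumr; apply: eq_bigr => k _.
by rewrite mdotZr mdotC // mdot_comb.
Qed.

Lemma spectral_projE (S : {set 'I_r}) x :
  spectral_proj M v S *m x
  = \sum_k (if k \in S then mdot M (v k) x else 0) *: v k.
Proof.
rewrite mulmx_suml [RHS](bigID (mem S)) /= [X in _ = _ + X]big1 ?addr0.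
  apply: eq_bigr => k  kS; rewrite kS.
  have -> : v k *m (v k)^T *m M *m x = v k *m ((v k)^T *m M *m x).
    by rewrite !mulmxA.
  rewrite [X in _ *m X]mx11_scalar.
  by rewrite mul_mx_scalar /mdot.
by move=> k /negPf ->; rewrite scale0r.
Qed.

(** Pythagoras for [x = p + (x - p)]: [<x,p>] and [<p,p>] are the same sum of squares. Dropping one
    or the other term gives Bessel's inequality and the contraction property of the complementary
    projection. *)
Lemma mdot_sub_spectral_proj (S : {set 'I_r}) x :
  let y := (1%:M - spectral_proj M v S) *m x in
  mdot M x x = mdot M y y + \sum_(k in S) mdot M (v k) x ^+ 2.
Proof.
have [sM _] := spdM.
rewrite /= mulmxBl mul1mx spectral_projE; set p := \sum_k _.
have px : mdot M x p = \sum_(k in S) mdot M (v k) x ^+ 2.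
  rewrite mdot_sumr [RHS]big_mkcond; apply: eq_bigr => k _.
  by rewrite mdotZr (mdotC x) //; case: ifP; rewrite ?mul0r ?expr2.
have pp : mdot M p p = \sum_(k in S) mdot M (v k) x ^+ 2.
  rewrite mdot_comb2 [RHS]big_mkcond; apply: eq_bigr => k _.
  by case: ifP; rewrite ?mul0r ?expr2.
rewrite mdotBr !(mdotC (x - p)) // !mdotBr (mdotC p x) // pp px; ring.
Qed.

Lemma bessel (S : {set 'I_r}) x :
  \sum_(k in S) mdot M (v k) x ^+ 2 <= mdot M x x.
Proof.
by rewrite (mdot_sub_spectral_proj S x) lerDr mdot_ge0.
Qed.

Lemma mnorm_sub_spectral_proj (S : {set 'I_r}) x :
  mnorm M ((1%:M - spectral_proj M v S) *m x) <= mnorm M x.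
Proof.
rewrite -[leRHS]mul1r mnorm_le // expr1n mul1r [leRHS](mdot_sub_spectral_proj S).
by rewrite lerDl sumr_ge0 // => k _; exact: sqr_ge0.
Qed.

End OrthonormalFamily.

(** * Diagonalisation of a pencil and Rayleigh quotients *)

Section Eigensystem.
Variables (R : realType) (n : nat) (A M : 'M[R]_n).
Variables (lam : 'I_n -> R) (phi : 'I_n -> 'cV[R]_n).
Hypotheses (spdA : spd A) (spdM : spd M) (eigAM : gen_eigensystem A M lam phi).

(** Orthonormality makes [(cols phi)^T *m M] a left inverse of the square matrix [cols phi], hence
    also a right inverse; applying that product to [x] gives the expansion. *)
Lemma eigen_expansion x : x = \sum_k mdot M (phi k) x *: phi k.
Proof.
have [_ _ orthophi] := eigAM.
have : (cols phi)^T *m M *m cols phi = 1%:M.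
  apply/matrixP => i k; rewrite [RHS]mxE -orthophi.
  rewrite /mdot [in RHS]mxE [in LHS]mxE; apply: eq_bigr => j _.
  congr (_ * _); last by rewrite mxE.
  by rewrite !mxE; apply: eq_bigr => j' _; rewrite !mxE.
move=> /mulmx1C /(congr1 (fun B => B *m x)).
rewrite mul1mx -mulmxA mul_cols => {1}<-; apply: eq_bigr => k _; congr (_ *: _).
rewrite mxE /mdot mxE; apply: eq_bigr => j _; congr (_ * _).
by rewrite !mxE; apply: eq_bigr => j' _; rewrite !mxE.
Qed.

Lemma mdot_eigenl k x : mdot A (phi k) x = lam k * mdot M (phi k) x.
Proof.
have [[[_ eigphi _] [sA _]] [sM _]] := (eigAM, spdA, spdM).
rewrite [LHS]mdotC // [LHS]/mdot -mulmxA eigphi -scalemxAr mulmxA.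
by rewrite [LHS]mxE -/(mdot M x (phi k)) mdotC //.
Qed.

Lemma mdot_eigenM x : mdot M x x = \sum_k mdot M (phi k) x ^+ 2.
Proof.
have [_ _ orthophi] := eigAM.
rewrite {1 2}(eigen_expansion x) (mdot_comb2 spdM orthophi).
by apply: eq_bigr => k _; rewrite expr2.
Qed.

Lemma mdot_eigenA x : mdot A x x = \sum_k lam k * mdot M (phi k) x ^+ 2.
Proof.
have [sA _] := spdA.
rewrite {2}(eigen_expansion x) mdot_sumr; apply: eq_bigr => k _.
by rewrite mdotZr (mdotC x) // mdot_eigenl expr2 mulrCA.
Qed.

(** Both quadratic forms are diagonal in the eigenbasis, and each surviving coordinate has weight
    [lam i <= lam k]. *)
Lemma rayleigh_le (k : 'I_n) x :
  (forall i : 'I_n, (k < i)%N -> mdot M (phi i) x = 0) ->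
  mdot A x x <= lam k * mdot M x x.
Proof.
have [lam_homo _ _] := eigAM => x0.
rewrite mdot_eigenM mdot_eigenA mulr_sumr; apply: ler_sum => i _.
have [ik|/x0 ->] := leqP i k; last by rewrite expr0n !mulr0.
by rewrite ler_wpM2r ?sqr_ge0 // lam_homo.
Qed.

Lemma rayleigh_ge (k : 'I_n) x :
  (forall i : 'I_n, (i < k)%N -> mdot M (phi i) x = 0) ->
  lam k * mdot M x x <= mdot A x x.
Proof.
have [lam_homo _ _] := eigAM => x0.
rewrite mdot_eigenM mdot_eigenA mulr_sumr; apply: ler_sum => i _.
have [ik|/x0 ->] := leqP k i; last by rewrite expr0n !mulr0.
by rewrite ler_wpM2r ?sqr_ge0 // lam_homo.
Qed.

Lemma eigenvector_neq0 k : phi k != 0.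
Proof.
have [_ _ orthophi] := eigAM; apply/eqP => phi0.
by have /eqP := orthophi k k; rewrite phi0 mdot0r eqxx eq_sym oner_eq0.
Qed.

Lemma eigenvalue_gt0 k : 0 < lam k.
Proof.
have [[_ _ orthophi] [_ pA]] := (eigAM, spdA).
have := pA _ (eigenvector_neq0 k).
by rewrite mdot_eigenl orthophi eqxx mulr1.
Qed.

(** A crude operator bound, enough to make [kappa] finite: expand [x] in the eigenbasis, each
    coordinate being at most the norm of [x]. *)
Lemma mnorm_mulmx_bounded (B : 'M[R]_n) :
  exists C, forall x, mnorm M (B *m x) <= C * mnorm M x.
Proof.
have [_ _ orthophi] := eigAM.
exists (\sum_k mnorm M (B *m phi k)) => x.
rewrite {1}(eigen_expansion x) mulmx_sumr mulr_suml.
apply: le_trans (mnorm_sum _ _ spdM) _; apply: ler_sum => k _.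
rewrite -scalemxAr mnormZ // mulrC ler_wpM2l ?mnorm_ge0 //.
apply: le_trans (mdot_le_mnorm _ _ spdM) _.
by rewrite [mnorm M (phi k)]/mnorm orthophi eqxx sqrtr1 mul1r.
Qed.

(** Pairing [A x] with [phi i] in two ways gives [(lam i - nu) <phi i, x> = 0]. *)
Lemma eigen_coord0 nu x i : A *m x = nu *: (M *m x) -> lam i != nu ->
  mdot M (phi i) x = 0.
Proof.
move=> Ax lam_nu; have := mdot_eigenl i x.
rewrite {1}/mdot -mulmxA Ax -scalemxAr mulmxA mxE -/(mdot M (phi i) x).
move/eqP; rewrite -subr_eq0 -mulrBl mulf_eq0 subr_eq0 eq_sym (negPf lam_nu).
by move/eqP.
Qed.

End Eigensystem.

(* Homogeneous system with one equation fewer than unknowns: row [k] of [F]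
   imposes nothing. *)
Lemma crossing_vector (R : realType) r (F : 'M[R]_r) (k : 'I_r) :
  exists c : 'cV[R]_r, [/\ c != 0,
    forall i : 'I_r, (k < i)%N -> c i 0 = 0
  & forall i : 'I_r, (i < k)%N -> (F *m c) i 0 = 0].
Proof.
(* Rows before [k] carry the equations of [F], rows after [k] force the coordinate to vanish, and
   the zero row [k] makes [B] singular. *)
pose B : 'M[R]_r := \matrix_(i, j)
  (if (i < k)%N then F i j else if (k < i)%N then (i == j)%:R else 0).
have : \det B^T = 0.
  by rewrite det_tr (expand_det_row _ k) big1 // => j _; rewrite mxE ltnn mul0r.
move=> /eqP/det0P[v v0 vB]; exists v^T.
have Bv : B *m v^T = 0 by apply: trmx_inj; rewrite trmx_mul trmxK vB trmx0.
split; first by rewrite -trmx0 (inj_eq trmx_inj).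
- move=> i ki; have /colP/(_ i) := Bv; rewrite !mxE (bigD1 i) //= big1 => [|j ji].
    by rewrite !mxE ltnNge (ltnW ki) ki eqxx mul1r addr0.
  by rewrite !mxE ltnNge (ltnW ki) ki eq_sym (negPf ji) mul0r.
- move=> i ik; have /colP/(_ i) := Bv; rewrite [LHS]mxE [RHS]mxE => Fc.
  by rewrite mxE -[RHS]Fc; apply: eq_bigr => j _; rewrite !mxE ik.
Qed.

(** * Compression to the range of [Q] and the A-orthogonal projection *)

Section Compression.
Variables (R : realType) (n r : nat) (A : 'M[R]_n) (Q : 'M[R]_(n, r)).
Hypotheses (spdA : spd A) (orthoQ : Q^T *m Q = 1%:M).

Lemma mdot_compress (M : 'M[R]_n) x y :
  mdot (compress Q M) x y = mdot M (Q *m x) (Q *m y).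
Proof. by rewrite mdot_mulmx. Qed.

Lemma compress_spd : spd (compress Q A).
Proof.
have [sA pA] := spdA; split; first by rewrite /compress !trmx_mul trmxK sA mulmxA.
move=> x x0; rewrite mdot_compress; apply: pA; apply: contra_neq x0 => Qx0.
by rewrite -[x]mul1mx -orthoQ -mulmxA Qx0 mulmx0.
Qed.

(** Galerkin orthogonality: [compress Q A] cancels against its inverse. *)
Lemma projA_orth u x : mdot A (Q *m u) (projA Q A *m x) = mdot A (Q *m u) x.
Proof.
rewrite /mdot trmx_mul -!mulmxA; congr ((_ *m _) 0 0).
rewrite /projA !mulmxA -/(compress Q A) mulmxV ?mul1mx //.
exact: spd_unitmx compress_spd.
Qed.

Lemma projA_im (x : 'cV[R]_n) : exists u, projA Q A *m x = Q *m u.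
Proof. by exists (invmx (compress Q A) *m Q^T *m A *m x); rewrite !mulmxA. Qed.

Lemma projA_contract x :
  mdot A (projA Q A *m x) (projA Q A *m x) <= mdot A x x.
Proof.
have [sA _] := spdA; have [u zE] := projA_im x.
set z := projA Q A *m x in zE *.
have zz : mdot A z x = mdot A z z by rewrite {1 2}zE /z projA_orth.
have := mdot_ge0 (x - z) spdA.
rewrite mdotBr !(mdotC (x - z)) // !mdotBr (mdotC x z) // zz; lra.
Qed.

End Compression.

(** * Finiteness and use of the constants [kappa] *)

Section Kappa.
Variables (R : realType) (n r : nat) (M P : 'M[R]_n) (v : 'I_r -> 'cV[R]_n).
Hypothesis spdM : spd M.
Hypothesis full_rank : \rank (P *m cols v) = r.

(** Full column rank makes the pseudo-inverse a left inverse, so [y] depends linearly on [P y]. This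
    gives injectivity of [P] on the span and, through boundedness, the bound on [kappa]. *)
Lemma full_rank_recover y S :
  y \in vspan v S -> y = cols v *m pinvmx (P *m cols v) *m (P *m y).
Proof.
case/vspanP => c _ ->; set w := \sum__ _.
have -> : w = cols v *m (\col_i c i).
  by rewrite mul_cols; apply: eq_bigr => i _; rewrite mxE.
have /mulVpmx pK : row_full (P *m cols v) by rewrite /row_full full_rank.
by rewrite (mulmxA P) -mulmxA (mulmxA (pinvmx _)) pK mul1mx.
Qed.

Lemma full_rank_neq0 y S : y \in vspan v S -> y != 0 -> P *m y != 0.
Proof.
by move=> /full_rank_recover yE; apply: contra_neq => Py; rewrite yE Py mulmx0.
Qed.

Lemma kappa_ratio y S : y \in vspan v S -> y != 0 ->
  ((mnorm M y)%:E / (mnorm M (P *m y))%:E)%E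
  = (mnorm M y / mnorm M (P *m y))%:E.
Proof.
move=> yS y0; have := mnorm_gt0 spdM (full_rank_neq0 yS y0).
by rewrite inver lt0r => /andP[/negPf -> _].
Qed.

Lemma kappa_lty k :
  (exists C, forall x, mnorm M (cols v *m pinvmx (P *m cols v) *m x)
                       <= C * mnorm M x) ->
  (kappa M P v k < +oo)%E.
Proof.
case=> C CP; apply: (@le_lt_trans _ _ C%:E); last exact: ltry.
apply: ge_ereal_sup => _ /= [y [y0 yS] <-]; rewrite (kappa_ratio yS y0) lee_fin.
rewrite ler_pdivrMr ?mnorm_gt0 ?(full_rank_neq0 yS) //.
by rewrite {1}(full_rank_recover yS).
Qed.

Lemma mdot_le_kappa k y : (kappa M P v k < +oo)%E ->
  y \in vspan v [set i : 'I_r | (i <= k)%N] -> y != 0 ->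
  exists2 K, (kappa M P v k ^+ 2)%E = (K ^+ 2)%:E &
    mdot M y y <= K ^+ 2 * mdot M (P *m y) (P *m y).
Proof.
move=> kappa_fin yk y0.
have ratio_le : ((mnorm M y / mnorm M (P *m y))%:E <= kappa M P v k)%E.
  by rewrite -(kappa_ratio yk y0); apply: ereal_sup_ubound; exists y.
(* The supremum is not [+oo] by assumption, nor [-oo] since it dominates the real quotient of
   [y]. *)
case: (kappa M P v k) kappa_fin ratio_le => [K| |] //= _.
rewrite lee_fin ler_pdivrMr ?mnorm_gt0 ?(full_rank_neq0 yk) // => yK.
exists K; first by rewrite EFin_expe.
have K_ge0 : 0 <= K.
  rewrite -(pmulr_lge0 _ (mnorm_gt0 spdM (full_rank_neq0 yk y0))).
  exact: le_trans (mnorm_ge0 _ _) yK.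
by rewrite -mnorm_le.
Qed.

End Kappa.

(** * Ritz values, Ritz vectors and the projection error *)

Section RitzVectors.
Variables (R : realType) (n r : nat) (le_rn : (r <= n)%N).
Variables (A M : 'M[R]_n) (Q : 'M[R]_(n, r)).
Variables (lam : 'I_n -> R) (phi : 'I_n -> 'cV[R]_n).
Variables (lamt : 'I_r -> R) (phih : 'I_r -> 'cV[R]_r).
Hypotheses (spdA : spd A) (spdM : spd M) (orthoQ : Q^T *m Q = 1%:M).
Hypothesis eigAM : gen_eigensystem A M lam phi.
Hypothesis eigAMh : gen_eigensystem (compress Q A) (compress Q M) lamt phih.

Let lamr (k : 'I_r) := lam (widen_ord le_rn k).
Let phir (k : 'I_r) := phi (widen_ord le_rn k).
Let phit (k : 'I_r) := Q *m phih k.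
Let PA := projA Q A.

Let spdAh : spd (compress Q A). Proof. exact: compress_spd. Qed.
Let spdMh : spd (compress Q M). Proof. exact: compress_spd. Qed.

Lemma ritz_ortho i k : mdot M (phit i) (phit k) = (i == k)%:R.
Proof. by have [_ _ <-] := eigAMh; rewrite mdot_compress. Qed.

Lemma phir_ortho i k : mdot M (phir i) (phir k) = (i == k)%:R.
Proof. by have [_ _ ->] := eigAM. Qed.

Lemma comb_neq0 (v : 'I_r -> 'cV[R]_n) (c : 'cV[R]_r) :
  (forall i k, mdot M (v i) (v k) = (i == k)%:R) -> c != 0 ->
  \sum_k c k 0 *: v k != 0.
Proof.
move=> orthov; apply: contra_neq => c0; apply/colP => i.
by rewrite -(mdot_comb orthov (fun k => c k 0)) c0 mdot0r mxE.
Qed.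

(** Translates the equations solved by [crossing_vector] into orthogonality relations. *)
Lemma mulmx_colsE m (v w : 'I_m -> 'cV[R]_n) B (c : 'cV[R]_m) i :
  ((cols v)^T *m M *m B *m cols w *m c) i 0
  = mdot M (v i) (B *m \sum_k c k 0 *: w k).
Proof.
rewrite -[_ *m _ *m c]mulmxA mul_cols -[_ *m B *m _]mulmxA.
rewrite mxE /mdot mxE; apply: eq_bigr => j _; congr (_ * _).
by rewrite !mxE; apply: eq_bigr => j' _; rewrite !mxE.
Qed.

Lemma eigenvalue_le_ritz k : lamr k <= lamt k.
Proof.
have [c [c0 c_gt c_lt]] :=
  crossing_vector ((cols phir)^T *m M *m 1%:M *m cols phit) k.
pose u := \sum_i c i 0 *: phih i.
have QuE : Q *m u = \sum_i c i 0 *: phit i.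
  by rewrite mulmx_sumr; apply: eq_bigr => i _; rewrite scalemxAr.
have Qu_gt0 : 0 < mdot M (Q *m u) (Q *m u).
  by have [_ pM] := spdM; rewrite pM // QuE comb_neq0 //; exact: ritz_ortho.
rewrite -(ler_pM2r Qu_gt0).
apply: (@le_trans _ _ (mdot A (Q *m u) (Q *m u))).
- apply: (rayleigh_ge spdA spdM eigAM) => i ik.
  have ir : (i < r)%N by exact: ltn_trans ik (ltn_ord k).
  have -> : i = widen_ord le_rn (Ordinal ir) by exact: val_inj.
  by have := c_lt (Ordinal ir) ik; rewrite mulmx_colsE mul1mx -QuE.
- rewrite -!mdot_compress; apply: (rayleigh_le spdAh spdMh eigAMh) => i ki.
  have [_ _ orthoh] := eigAMh.
  by rewrite (mdot_comb orthoh (fun k => c k 0)) c_gt.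
Qed.

Lemma ritz_le_kappa k : \rank (PA *m cols phir) = r ->
  (kappa M PA phir k < +oo)%E ->
  ((lamt k)%:E <= kappa M PA phir k ^+ 2 * (lamr k)%:E)%E.
Proof.
move=> full_rank kappa_fin.
have [c [c0 c_gt c_lt]] :=
  crossing_vector ((cols phit)^T *m M *m PA *m cols phir) k.
pose y := \sum_i c i 0 *: phir i.
have y0 : y != 0 by rewrite comb_neq0 //; exact: phir_ortho.
have yk : y \in vspan phir [set i : 'I_r | (i <= k)%N].
  apply/vspanP; exists (fun i => c i 0) => // i.
  by rewrite inE -ltnNge => /c_gt.
have [K -> yK] := mdot_le_kappa spdM full_rank kappa_fin yk y0.
have [u zE] := projA_im A Q y; rewrite -/PA in zE.
have z_gt0 : 0 < mdot M (PA *m y) (PA *m y).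
  by have [_ pM] := spdM; rewrite pM // (full_rank_neq0 full_rank yk).
(* With [z = PA y], the chain is [lamt k <z,z>_M <= <z,z>_A <= <y,y>_A <= lamr k <y,y>_M <= lamr k
   K^2 <z,z>_M]. *)
rewrite -EFinM lee_fin -(ler_pM2r z_gt0).
apply: (@le_trans _ _ (mdot A (PA *m y) (PA *m y))).
  rewrite zE -!mdot_compress; apply: (rayleigh_ge spdAh spdMh eigAMh) => i ik.
  by have := c_lt i ik; rewrite mulmx_colsE -/y zE mdot_compress.
apply: le_trans (projA_contract spdA orthoQ y) _.
apply: (@le_trans _ _ (lamr k * mdot M y y)).
  apply: (rayleigh_le spdA spdM eigAM) => i ki.
  have [ir|ri] := ltnP i r.
    have -> : i = widen_ord le_rn (Ordinal ir) by exact: val_inj.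
    rewrite -/(phir _) (mdot_comb phir_ortho (fun k => c k 0)).
    exact: c_gt.
  (* For an index [i >= r], [phi i] is orthogonal to every [phir j], hence to [y]. *)
  have [_ _ orthophi] := eigAM.
  rewrite mdot_sumr big1 // => j _; rewrite mdotZr orthophi.
  case: eqP => [ij|_]; last by rewrite mulr0.
  by move: ri; rewrite ij leqNgt /= ltn_ord.
rewrite [X in _ <= X * _]mulrC -mulrA ler_wpM2l //.
exact: ltW (eigenvalue_gt0 spdA spdM eigAM _).
Qed.

(** Eigenvectors for distinct eigenvalues are orthogonal, so the expansion of a solution [x] keeps
    only indices with eigenvalue [nu], all of them below [r] by hypothesis. *)
Lemma mem_eigenspace (nu : R) x :
  (forall i : 'I_n, (r <= i)%N -> lam i != nu) ->
  x \in vspan phir (eigenset lamr nu) <-> A *m x = nu *: (M *m x).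
Proof.
move=> lam_ge; split=> [/vspanP[c c0 ->]|Ax].
  have [_ eigphi _] := eigAM.
  rewrite !mulmx_sumr scaler_sumr; apply: eq_bigr => k _.
  rewrite -!scalemxAr eigphi !scalerA -/(lamr k).
  have [kS|/c0 ->] := boolP (k \in eigenset lamr nu); last first.
    by rewrite !(mul0r, mulr0).
  by move: kS; rewrite inE => /eqP ->; rewrite mulrC.
apply/vspanP; exists (fun k => mdot M (phir k) x) => [k|].
  by rewrite inE => /(eigen_coord0 spdA spdM eigAM Ax).
rewrite {1}(eigen_expansion eigAM x).
rewrite (bigID (fun i : 'I_n => (i < r)%N)) /= [X in _ + X]big1 ?addr0.
  by rewrite (big_ord_narrow le_rn).
move=> i; rewrite -leqNgt => /lam_ge /(eigen_coord0 spdA spdM eigAM Ax) ->.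
by rewrite scale0r.
Qed.

(** Inversion reverses order on the nonzero gaps, and [k] itself shows that the default branch of
    [tau] is not taken. *)
Lemma tau_ge (nu : R) (S : {set 'I_r}) k : 0 <= nu -> k \notin S ->
  (forall i, i \notin S -> nu != lamt i) -> nu / `|nu - lamt k| <= tau nu lamt S.
Proof.
move=> nu_ge0 kS nu_lamt; rewrite /tau; case: pickP => [k0 k0S|/(_ k)]; last first.
  by rewrite inE kS.
case: arg_minP => //= i iS /(_ k); rewrite !inE in iS * => /(_ kS) le_ik.
by rewrite ler_wpM2l // lef_pV2 ?posrE ?normr_gt0 ?subr_eq0 ?nu_lamt.
Qed.

Lemma tau_ge0 (nu : R) (S : {set 'I_r}) : 0 <= nu -> 0 <= tau nu lamt S.
Proof.
by move=> nu_ge0; rewrite /tau; case: pickP => // k _; rewrite divr_ge0.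
Qed.

(* With [z = PA x] and [e = x - z], Galerkin orthogonality gives
   [lamt k * <phit k, z> = nu * <phit k, x>], that is
   [(lamt k - nu) * <phit k, z> = nu * <phit k, e>]. *)
Lemma ritz_coord_le (nu : R) x (S : {set 'I_r}) k : 0 <= nu ->
  A *m x = nu *: (M *m x) -> k \notin S ->
  (forall i, i \notin S -> nu != lamt i) ->
  `|mdot M (phit k) (PA *m x)|
  <= tau nu lamt S * `|mdot M (phit k) ((1%:M - PA) *m x)|.
Proof.
move=> nu_ge0 Ax kS nu_lamt.
apply: le_trans (ler_wpM2r (normr_ge0 _) (tau_ge nu_ge0 kS nu_lamt)).
have nk : 0 < `|nu - lamt k| by rewrite normr_gt0 subr_eq0 nu_lamt.
have [u zE] := projA_im A Q x; rewrite -/PA in zE.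
have galerkin : lamt k * mdot M (phit k) (PA *m x) = nu * mdot M (phit k) x.
  rewrite zE -mdot_compress -(mdot_eigenl spdAh spdMh eigAMh).
  rewrite mdot_compress -zE (projA_orth spdA orthoQ).
  by rewrite /mdot -mulmxA Ax -scalemxAr mulmxA [LHS]mxE.
rewrite mulrAC ler_pdivlMr // -normrM -[X in _ <= X * _](ger0_norm nu_ge0) -normrM.
rewrite mulmxBl mul1mx mdotBr (mulrBr nu) -galerkin -mulrBl.
by rewrite mulrC -(opprB nu) mulNr normrN.
Qed.

Lemma ritz_projection_error (nu : R) x (S : {set 'I_r}) : 0 <= nu ->
  A *m x = nu *: (M *m x) ->
  (forall i, i \notin S -> nu != lamt i) ->
  mnorm M ((1%:M - spectral_proj M phit S) *m x)
  <= (1 + tau nu lamt S) * mnorm M ((1%:M - PA) *m x).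
Proof.
move=> nu_ge0 Ax nu_lamt; set e := (1%:M - PA) *m x.
have t_ge0 := tau_ge0 S nu_ge0.
have {1}-> : x = e + PA *m x by rewrite /e mulmxBl mul1mx subrK.
rewrite mulmxDr mulrDl mul1r; apply: le_trans (mnormD _ _ spdM) _.
apply: lerD; first exact: (mnorm_sub_spectral_proj spdM ritz_ortho).
rewrite mnorm_le //.
(* [PA x] lies in the range of [Q], so its Ritz expansion is exact and the projection just deletes
   the terms in [S]. *)
have -> : (1%:M - spectral_proj M phit S) *m (PA *m x)
    = \sum_k (if k \in S then 0 else mdot M (phit k) (PA *m x)) *: phit k.
  have [u zE] := projA_im A Q x; rewrite -/PA in zE.
  rewrite mulmxBl mul1mx spectral_projE {1}zE (eigen_expansion eigAMh u).
  rewrite mulmx_sumr -sumrB; apply: eq_bigr => k _.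
  rewrite -scalemxAr mdot_compress -zE -scalerBl.
  by case: ifP; rewrite ?subrr ?subr0.
rewrite (mdot_comb2 spdM ritz_ortho).
(* Bessel over the complement of [S] reduces the claim to a comparison coordinate by coordinate. *)
apply: le_trans (ler_wpM2l (sqr_ge0 _) (bessel spdM ritz_ortho (~: S) e)).
rewrite mulr_sumr [leRHS]big_mkcond; apply: ler_sum => k _; rewrite inE.
have [kS|kS] /= := boolP (k \in S); first by rewrite mulr0.
rewrite -expr2 -exprMn -[leLHS]real_normK ?num_real //.
rewrite -[leRHS]real_normK ?num_real // lerXn2r ?nnegrE //.
by rewrite normrM (ger0_norm t_ge0) ritz_coord_le.
Qed.

End RitzVectors.

Theorem theorem4p7 (R : realType) (n r : nat) (r_gt0 : (0 < r)%N)
    (le_rn : (r <= n)%N)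
    (A M : 'M[R]_n) (spdA : spd A) (spdM : spd M)
    (Q : 'M[R]_(n, r)) (orthoQ : Q^T *m Q = 1%:M)
    (lam : 'I_n -> R) (phi : 'I_n -> 'cV[R]_n)
    (eigAM : gen_eigensystem A M lam phi)
    (lamt : 'I_r -> R) (phih : 'I_r -> 'cV[R]_r)
    (eigAMh : gen_eigensystem (compress Q A) (compress Q M) lamt phih) :
  let lamr (k : 'I_r) := lam (widen_ord le_rn k) in
  let phir (k : 'I_r) := phi (widen_ord le_rn k) in
  let phit (k : 'I_r) := Q *m phih k in
  let PA := projA Q A in
  forall (full_rank : \rank (PA *m cols phir) = r)
    (gap : r = n \/
       exists i k : 'I_n, [/\ i.+1 = r, k = r :> nat & lam i < lam k])
    (l : nat) (nu : 'I_l -> R)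
    (nu_incr : forall i j : 'I_l, (i < j)%N -> nu i < nu j)
    (nu_values : forall x : R,
       (exists j, nu j = x) <-> (exists k, lamr k = x)),
  (forall k : 'I_r, (kappa M PA phir k < +oo)%E) /\
  forall j : 'I_l,
  let S := eigenset lamr (nu j) in
  (forall x : 'cV[R]_n,
     x \in vspan phir S <-> A *m x = nu j *: (M *m x)) /\
  ((forall k : 'I_r, k \notin S ->
      (nu j)%:E \notin
        `[(lamr k)%:E, (kappa M PA phir k ^+ 2 * (lamr k)%:E)%E]) ->
   (forall k : 'I_r, k \notin S -> nu j != lamt k) /\
   forall x : 'cV[R]_n, x \in vspan phir S ->
     mnorm M ((1%:M - spectral_proj M phit S) *m x)
       <= (1 + tau (nu j) lamt S) * mnorm M ((1%:M - PA) *m x)).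
Proof.
move=> lamr phir phit PA full_rank gap l nu nu_incr nu_values.
have kappa_fin k : (kappa M PA phir k < +oo)%E.
  by apply: (kappa_lty spdM full_rank); exact: (mnorm_mulmx_bounded spdM eigAM).
split=> // j S; have [lam_homo _ _] := eigAM.
have [k0 nuj] : exists k, lamr k = nu j by apply/nu_values; exists j.
(* Indices start at 0, so [i0] and [k] below stand for the r-th and (r+1)-st eigenvalues:
   [nu j <= lam i0 < lam k <= lam i]. If [r = n] there is no such [i]. *)
have lam_ge (i : 'I_n) : (r <= i)%N -> lam i != nu j.
  move=> ri; rewrite gt_eqF //.
  case: gap => [rn|[i0 [k [i0r kr lt_ik]]]].
    by move: ri; rewrite rn leqNgt ltn_ord.
  apply: le_lt_trans (lt_le_trans lt_ik _); last by rewrite lam_homo // kr.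
  by rewrite -nuj lam_homo // -ltnS i0r /=.
have mem_E x := mem_eigenspace le_rn spdA spdM eigAM x lam_ge.
split=> // nu_notin.
(* If [nu j] were [lamt k], the two Courant-Fischer bounds would place it in the excluded
   interval. *)
have nu_lamt k : k \notin S -> nu j != lamt k.
  move=> /nu_notin; apply: contraNneq => ->.
  rewrite in_itv /= lee_fin.
  rewrite (eigenvalue_le_ritz le_rn spdA spdM orthoQ eigAM eigAMh).
  exact: (ritz_le_kappa spdA spdM orthoQ eigAM eigAMh full_rank (kappa_fin k)).
split=> // x /mem_E Ax.
apply: (ritz_projection_error spdA spdM orthoQ eigAMh) => //.
by rewrite -nuj ltW // (eigenvalue_gt0 spdA spdM eigAM).
Qed.
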